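(* Let $Y_1,\dots,Y_n$ be observations from the sparse deconvolution model of the context, with $\theta_i$ having distribution $f(x)=\mu_nf_0(x)+(1-\mu_n)\delta(x)$, and let $\Phi_\mu=\int\varphi(x)f_0(x)\,dx$. If $g(x)=\mathcal N(x|0,\sigma^2)$ is a Gaussian pdf (mean $0$, variance $\sigma^2$) and $\int_{-\infty}^\infty|\varphi(x)|g(x)\,dx<\infty$, then the lower bound $$\inf_{\widetilde\Phi_\mu}\ \sup_{f_1,f_2}\ \mathbb E(\widetilde\Phi_\mu-\Phi_\mu)^2\ge C\min\big(1,(n\mu_n^2)^{-1}\big)$$ holds, where $\widetilde\Phi_\mu$ is any estimator of $\Phi_\mu$ based on $Y_1,\dots,Y_n$, and the supremum is over pdfs $f_1,f_2$ (taken in the role of $f_0$) as described in the context.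
   Context: Model: $Y_i=\theta_i+\xi_i$, $i=1,\dots,n$, where $\xi_i$ are i.i.d. with known pdf $g$, independent of the i.i.d. $\theta_i$, whose distribution is $f(x)=\mu_nf_0(x)+(1-\mu_n)\delta(x)$; here $\delta$ is the Dirac delta at $0$, $\mu_n$ is known and $f_0$ is an unknown pdf. $\varphi$ is a known function. $C$ denotes a positive constant independent of $n$. In the lower bound, $f_1,f_2$ are two pdfs such that, for some $C_I>0$, $$\int_{-\infty}^\infty g^{-1}(x)\Big[\int_{-\infty}^\infty g(x-\theta)f_k(\theta)\,d\theta\Big]^2dx\le C_I<\infty,\quad k=1,2,\qquad \int_{-\infty}^\infty\varphi(\theta)[f_1(\theta)-f_2(\theta)]\,d\theta\ne0.$$ *)

(* Defs.v *)
From HB Require Import structures.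
From mathcomp Require Import all_boot all_order all_algebra.
From mathcomp Require Import all_classical all_reals all_analysis.
From mathcomp Require Import measurable_realfun.
Import Order.TTheory GRing.Theory Num.Theory.
Import numFieldNormedType.Exports.

Set Implicit Arguments.
Unset Strict Implicit.
Unset Printing Implicit Defensive.

Local Open Scope classical_set_scope.
Local Open Scope ring_scope.
Local Open Scope ereal_scope.

Record pdf (R : realType) := Pdf {
  pdf_fun :> R -> R ;
  measurable_pdf : measurable_fun [set: R] pdf_fun ;
  pdf_ge0 : forall x, (0 <= pdf_fun x)%R ;
  integral_pdf : \int[lebesgue_measure]_x (pdf_fun x)%:E = 1 }.

Section pdf_law.
Context {R : realType} (f : pdf R).

Definition pdf_law (A : set (measurableTypeR R)) : \bar R :=
  \int[lebesgue_measure]_(x in A) (f x)%:E.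

Let pdf_law0 : pdf_law set0 = 0.
Proof. exact: integral_set0. Qed.

Let pdf_law_ge0 A : 0 <= pdf_law A.
Proof. by apply: integral_ge0 => x _; rewrite lee_fin pdf_ge0. Qed.

Let pdf_law_sigma_additive : semi_sigma_additive pdf_law.
Proof.
move=> /= F mF tF mUF; rewrite /pdf_law ge0_integral_bigcup//=.
- apply: is_cvg_ereal_nneg_natsum_cond => n _ _.
  by apply: integral_ge0 => x _; rewrite lee_fin pdf_ge0.
- apply/measurable_EFinP; apply: measurable_funTS; exact: measurable_pdf.
- by move=> x _; rewrite lee_fin pdf_ge0.
Qed.

HB.instance Definition _ := isMeasure.Build _ _ _ pdf_law
  pdf_law0 pdf_law_ge0 pdf_law_sigma_additive.

Let pdf_law_setT : pdf_law [set: _] = 1.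
Proof. exact: integral_pdf. Qed.

HB.instance Definition _ :=
  @Measure_isProbability.Build _ _ R pdf_law pdf_law_setT.

End pdf_law.

Section theta_law.
Context {R : realType} (mu : {i01 R}) (f0 : pdf R).

(* The law [mu * f0(x) dx + (1 - mu) * delta_0(dx)] of each theta_i. *)
Definition theta_law (A : set (measurableTypeR R)) : \bar R :=
  (mu%:num)%:E * pdf_law f0 A + (1 - mu%:num)%:E * \d_(0%R : measurableTypeR R) A.

Let mu_ge0 : (0 <= mu%:num)%R.
Proof. by []. Qed.

Let mu_le1 : (0 <= 1 - mu%:num)%R.
Proof. by rewrite subr_ge0. Qed.

Let theta_lawE : theta_law =
  measure_add (mscale (NngNum mu_ge0) (pdf_law f0))
    (mscale (NngNum mu_le1) \d_(0%R : measurableTypeR R)).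
Proof. by apply/funext => A; rewrite measure_addE. Qed.

Let theta_law0 : theta_law set0 = 0.
Proof. by rewrite theta_lawE; exact: measure0. Qed.

Let theta_law_ge0 A : 0 <= theta_law A.
Proof. by rewrite theta_lawE. Qed.

Let theta_law_sigma_additive : semi_sigma_additive theta_law.
Proof. by rewrite theta_lawE; exact: measure_semi_sigma_additive. Qed.

HB.instance Definition _ := isMeasure.Build _ _ _ theta_law
  theta_law0 theta_law_ge0 theta_law_sigma_additive.

Let theta_law_setT : theta_law [set: _] = 1.
Proof.
rewrite /theta_law probability_setT diracT !mule1 -EFinD.
by rewrite addrC subrK.
Qed.

HB.instance Definition _ :=
  @Measure_isProbability.Build _ _ R theta_law theta_law_setT.

End theta_law.

Section iid.
Context d (T : measurableType d) (R : realType) (P : probability T R).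

Definition tuple_cons n (x : T * n.-tuple T) : n.+1.-tuple T :=
  [tuple of x.1 :: x.2].

Lemma measurable_tuple_cons n : measurable_fun [set: T * n.-tuple T] (@tuple_cons n).
Proof. exact: (measurable_cons measurable_fst measurable_snd). Qed.

HB.instance Definition _ n :=
  isMeasurableFun.Build _ _ _ _ (@tuple_cons n) (@measurable_tuple_cons n).

(* The n-fold product P x ... x P: the joint law of n i.i.d. draws from P. *)
Fixpoint iid n : probability (n.-tuple T) R :=
  if n is m.+1
  then distribution (P \x iid m)%E (@tuple_cons m)
  else @dirac _ (0.-tuple T) [tuple] R.

End iid.

Section model.
Context {R : realType} (sigma : R) (mu : {i01 R}).

(* The law of (theta_i, xi_i), with xi_i ~ N(0, sigma^2) independent of
   theta_i; [normal_prob] takes the standard deviation. *)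
Definition signal_noise_law (f0 : pdf R) :
    probability (measurableTypeR R * measurableTypeR R)%type R :=
  (theta_law mu f0 \x normal_prob 0 sigma)%E.

Definition observations n
    (w : n.-tuple (measurableTypeR R * measurableTypeR R)%type) :
    n.-tuple (measurableTypeR R) :=
  [tuple ((tnth w i).1 + (tnth w i).2)%R | i < n].

Variable phi : R -> R.

Definition functional (f0 : pdf R) : R :=
  (\int[lebesgue_measure]_x (phi x * f0 x))%R.

Definition risk n (est : n.-tuple (measurableTypeR R) -> R) (f0 : pdf R) :
    \bar R :=
  'E_(iid (signal_noise_law f0) n)
    [fun w => ((est (observations w) - functional f0) ^+ 2)%R].

Definition estimators n : set (n.-tuple (measurableTypeR R) -> R) :=
  [set est | measurable_fun [set: n.-tuple (measurableTypeR R)] est].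

Definition minimax_risk n (F : set (pdf R)) : \bar R :=
  ereal_inf [set ereal_sup [set risk est f0 | f0 in F] | est in @estimators n].

End model.

Section candidates.
Context {R : realType} (sigma : R) (phi : R -> R).

Local Notation g := (normal_pdf 0 sigma).

Definition inverse_weighted_energy (f : pdf R) : \bar R :=
  \int[lebesgue_measure]_x
    ((g x)^-1%:E *
     (\int[lebesgue_measure]_theta (g (x - theta) * f theta)%:E) ^+ 2).

(* The integrability of [phi * f_k] is what makes the functional of f_k, and
   hence the difference of the two functionals, well defined. *)
Definition candidate_pair (C_I : R) (f1 f2 : pdf R) : Prop :=
  [/\ inverse_weighted_energy f1 <= C_I%:E,
      inverse_weighted_energy f2 <= C_I%:E,
      lebesgue_measure.-integrable [set: R] (fun x => (phi x * f1 x)%:E),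
      lebesgue_measure.-integrable [set: R] (fun x => (phi x * f2 x)%:E) &
      (\int[lebesgue_measure]_x (phi x * (f1 x - f2 x)) != 0)%R].

(* The densities f0 over which the supremum "over f1, f2" ranges. *)
Definition candidates (C_I : R) : set (pdf R) :=
  [set f0 | exists f1 f2 : pdf R,
    candidate_pair C_I f1 f2 /\ (f0 = f1 \/ f0 = f2)].

End candidates.

(* Main.v *)
(* Le Cam's two-point method.  For a candidate pair f1, f2 the mixtures
   f0 = (f1 + f2) / 2 and fe = f0 + e (f2 - f1) / 2 with
   e^2 = min(1, 1 / (n mu^2)) are again candidates, and their functionals
   differ by a multiple of e.  The chi-square distance between the laws of one
   observation is at most (mu e)^2 (C_I + 2) <= (C_I + 2) / n: the density of the
   observation dominates g / 2 when mu <= 1/2, where the energy bound applies,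
   and a quarter of g * (f1 + f2) when mu >= 1/2.  So the second moment of the
   likelihood ratio of n observations stays below exp(C_I + 2).
   Candidates exist because a non-constant phi has different averages over two
   bounded sets, and every density supported in [-m, m] has bounded energy. *)

Require Import Defs.
From HB Require Import structures.
From mathcomp Require Import all_boot all_order all_algebra.
From mathcomp Require Import all_classical all_reals all_analysis.
From mathcomp Require Import measurable_realfun ring lra.
Import Order.TTheory GRing.Theory Num.Theory.
Import numFieldNormedType.Exports.
Set Implicit Arguments.
Unset Strict Implicit.
Unset Printing Implicit Defensive.

Local Open Scope classical_set_scope.
Local Open Scope ring_scope.

(** * Integration against a measure given by a density *)

Section density.
Context d (T : measurableType d) (R : realType).
Variables (nu m : {measure set T -> \bar R}) (f : T -> R).
Hypotheses (measurable_f : measurable_fun [set: T] f)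
  (f_ge0 : forall x, 0 <= f x)
  (nuE : forall A, measurable A -> nu A = (\int[m]_(x in A) (f x)%:E)%E).
Local Open Scope ereal_scope.

Import HBNNSimple.

(** Both sides are limits along an increasing sequence of simple functions approximating [F], by
    monotone convergence; for a simple function the identity is [nuE] applied to each level set. *)
Lemma ge0_integral_density (F : T -> \bar R) :
  measurable_fun [set: T] F -> (forall x, 0 <= F x) ->
  \int[nu]_x F x = \int[m]_x (F x * (f x)%:E).
Proof.
move=> mF F0; pose h := nnsfun_approx measurableT mF.
have hF x : (EFin \o h n) x @[n --> \oo] --> F x by exact: cvg_nnsfun_approx.
have mhf n : measurable_fun [set: T] (fun x => (h n x)%:E * (f x)%:E).
  by apply: emeasurable_funM; exact/measurable_EFinP.
have -> : \int[nu]_x F x = lim (\int[nu]_x (EFin \o h n) x @[n --> \oo]).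
  rewrite -monotone_convergence//.
  - by apply: eq_integral => x _; apply/esym/cvg_lim => //; exact: hF.
  - by move=> n; exact/measurable_EFinP.
  - by move=> n x _; rewrite lee_fin.
  - by move=> x _ a b ab; rewrite lee_fin; exact/lefP/nd_nnsfun_approx.
have -> : \int[m]_x (F x * (f x)%:E) =
    lim (\int[m]_x ((h n x)%:E * (f x)%:E) @[n --> \oo]).
  rewrite -monotone_convergence//.
  - by apply: eq_integral => x _; apply/esym/cvg_lim => //; apply: cvgeZr => //; exact: hF.
  - by move=> n x _; rewrite mule_ge0// lee_fin.
  - move=> x _ a b ab; rewrite lee_wpmul2r ?lee_fin//.
    exact/lefP/nd_nnsfun_approx.
(* What remains concerns one simple function, split over its finitely many values. *)
congr (lim _); apply: congr2 => //; apply/funext => n.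
have mI r : measurable (h n @^-1` [set r]) by [].
under eq_integral do rewrite /= fimfunE -fsumEFin//.
rewrite ge0_integral_fsum//; last 2 first.
  - by move=> r; apply/measurable_EFinP/measurable_funM.
  - by move=> r x _; exact: nnfun_muleindic_ge0.
under [RHS]eq_integral.
  move=> x _; rewrite fimfunE -fsumEFin// ge0_mule_fsuml; last first.
    by move=> r; exact: nnfun_muleindic_ge0.
  over.
rewrite ge0_integral_fsum//; last 2 first.
  - move=> r; apply: emeasurable_funM; last exact/measurable_EFinP.
    by apply/measurable_EFinP/measurable_funM.
  - by move=> r x _; rewrite mule_ge0 ?lee_fin//; exact: nnfun_muleindic_ge0.
apply: eq_fsbigr => r /[!inE] rh; rewrite integralZl_indic_nnsfun//.
have r0 : (0 <= r)%R by case: rh => x _ <-.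
under [RHS]eq_integral do rewrite EFinM -muleA.
rewrite ge0_integralZl//; last 2 first.
  - apply: emeasurable_funM; last exact/measurable_EFinP.
    by apply/measurable_EFinP.
  - by move=> x _; rewrite mule_ge0// lee_fin.
congr (_ * _); rewrite integral_indic// setIT nuE// integral_mkcond.
by apply: eq_integral => x _; rewrite muleC epatch_indic.
Qed.

End density.

(** * Translation invariance of Lebesgue measure *)

Section translation.
Context {R : realType}.
Local Notation leb := (@lebesgue_measure R).
Local Open Scope ereal_scope.

(** Lebesgue measure is determined by its values on half-open intervals, and the preimage of such an
    interval under a shift has the same length. *)
Lemma lebesgue_measureD (a : R) (A : set R) : measurable A ->
  pushforward leb (+%R a : _ -> measurableTypeR R) A = leb A.
Proof.
move=> mA; apply/esym/lebesgue_measure_unique => // [|? _ [[u v]] _ <-].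
  exact: measurable_funD.
rewrite /= /pushforward.
rewrite (_ : _ @^-1` _ = [set` `]u - a, v - a]%R]); last first.
  by apply/seteqP; split => x /=; rewrite !in_itv/= ltrBlDl lerBrDl.
by rewrite !lebesgue_measure_itv/= !lte_fin ltrD2r -EFinB -EFinB opprB addrA subrK.
Qed.

Lemma ge0_integral_shift (a : R) (F : R -> \bar R) :
  measurable_fun [set: R] F -> (forall x, 0 <= F x) ->
  \int[leb]_x F (a + x)%R = \int[leb]_x F x.
Proof.
move=> mF F0; rewrite -(@ge0_integral_pushforward _ _ _ _ R
  (+%R a : measurableTypeR R -> measurableTypeR R) _ leb [set: R] F)//=.
  by apply: eq_measure_integral => [|? A mA _];
    [exact: measurable_funD|exact: lebesgue_measureD].
exact: measurable_funD.
Qed.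

End translation.

(** * Density of a single observation *)

Section observation_density.
Context {R : realType} (sigma : R) (sigma_neq0 : sigma != 0).
Local Notation leb := (@lebesgue_measure R).
Local Notation g := (normal_pdf 0 sigma).
Implicit Types (f : pdf R) (mu : {i01 R}) (F : R -> \bar R).

Lemma normal_pdf_gt0 x : 0 < g x.
Proof. by rewrite normal_pdfE// mulr_gt0 ?normal_peak_gt0// expR_gt0. Qed.

(** Density of theta + xi when theta has density [f]. Passing through [fine] loses nothing: the
    integral is finite by [convolutionE]. *)
Definition convolution f (x : R) : R :=
  fine (\int[leb]_theta (g (x - theta) * f theta)%:E)%E.

Lemma measurable_kernel f :
  measurable_fun [set: R * R] (fun p : R * R => (g (p.1 - p.2) * f p.2)%:E).
Proof.
apply/measurable_EFinP/measurable_funM.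
  by apply: (measurableT_comp (measurable_normal_pdf _ _)); exact: measurable_funB.
exact: (measurableT_comp (measurable_pdf f)).
Qed.

Lemma kernel_ge0 f x y : 0 <= g x * f y.
Proof. by rewrite mulr_ge0 ?normal_pdf_ge0 ?pdf_ge0. Qed.

(** The Gaussian kernel is bounded by its peak and [f] has mass 1, so the integral is finite. *)
Lemma convolutionE f x :
  (\int[leb]_theta (g (x - theta) * f theta)%:E)%E = (convolution f x)%:E.
Proof.
rewrite /convolution fineK// ge0_fin_numE; last first.
  by apply: integral_ge0 => y _; rewrite lee_fin kernel_ge0.
apply: (@le_lt_trans _ _ (\int[leb]_theta ((normal_peak sigma)%:E * (f theta)%:E))%E).
  apply: ge0_le_integral => //.
  - by move=> y _; rewrite lee_fin kernel_ge0.
  - exact: (measurableT_comp (measurable_kernel f) (pair1_measurable x)).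
  - apply: emeasurable_funM => //; apply/measurable_EFinP; exact: measurable_pdf.
  - by move=> y _; rewrite -EFinM lee_fin ler_wpM2r ?pdf_ge0 ?normal_pdf_ub.
rewrite ge0_integralZl//.
- by rewrite integral_pdf mule1 ltry.
- apply/measurable_EFinP; exact: measurable_pdf.
- by move=> y _; rewrite lee_fin pdf_ge0.
- by rewrite lee_fin normal_peak_ge0.
Qed.

Lemma convolution_ge0 f x : 0 <= convolution f x.
Proof.
by apply: fine_ge0; apply: integral_ge0 => y _; rewrite lee_fin kernel_ge0.
Qed.

Lemma measurable_convolution f : measurable_fun [set: R] (convolution f).
Proof.
apply/measurable_EFinP; rewrite (_ : _ \o _ = fubini_F leb
    (fun p : R * R => (g (p.1 - p.2) * f p.2)%:E)); last first.
  by apply/funext => x; rewrite /fubini_F/= -convolutionE.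
apply: measurable_fun_fubini_tonelli_F; first exact: measurable_kernel.
by move=> x; rewrite lee_fin kernel_ge0.
Qed.

Lemma integral_pdf_law f F :
  measurable_fun [set: R] F -> (forall x, 0 <= F x)%E ->
  (\int[pdf_law f]_x F x = \int[leb]_x (F x * (f x)%:E))%E.
Proof.
move=> mF F0; apply: (@ge0_integral_density _ _ _ (pdf_law f) leb) => //.
- exact: measurable_pdf.
- exact: pdf_ge0.
Qed.

Lemma integral_normal_prob F :
  measurable_fun [set: R] F -> (forall x, 0 <= F x)%E ->
  (\int[normal_prob 0 sigma]_x F x = \int[leb]_x (F x * (g x)%:E))%E.
Proof.
move=> mF F0; apply: (@ge0_integral_density _ _ _ (normal_prob 0 sigma) leb) => //.
- exact: measurable_normal_pdf.
- exact: normal_pdf_ge0.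
Qed.

Lemma integral_theta_law mu f F :
  measurable_fun [set: R] F -> (forall x, 0 <= F x)%E ->
  (\int[theta_law mu f]_x F x =
   mu%:num%:E * \int[leb]_x (F x * (f x)%:E) + (1 - mu%:num)%:E * F 0%R)%E.
Proof.
move=> mF F0.
have mu0 : 0 <= mu%:num by [].
have mu1 : 0 <= 1 - mu%:num by rewrite subr_ge0.
rewrite (@eq_measure_integral _ (measurableTypeR R) _ _ (measure_add
    (mscale (NngNum mu0) (pdf_law f))
    (mscale (NngNum mu1) \d_(0 : measurableTypeR R)))); last first.
  by move=> A _ _; rewrite /measure_add/= /msum 2!big_ord_recl/= big_ord0 adde0.
rewrite ge0_integral_measure_add// !ge0_integral_mscale//=.
by rewrite integral_pdf_law// integral_dirac// diracT mul1e.
Qed.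

(** The atom of theta at 0 leaves pure noise, hence the summand with [g] itself. *)
Definition observation_pdf mu f (y : R) : R :=
  mu%:num * convolution f y + (1 - mu%:num) * g y.

Lemma observation_pdf_ge0 mu f y : 0 <= observation_pdf mu f y.
Proof.
by rewrite addr_ge0// mulr_ge0 ?convolution_ge0 ?normal_pdf_ge0// subr_ge0.
Qed.

Lemma measurable_observation_pdf mu f :
  measurable_fun [set: R] (observation_pdf mu f).
Proof.
apply: measurable_funD; apply: measurable_funM => //.
  exact: measurable_convolution.
exact: measurable_normal_pdf.
Qed.

(** Tonelli with the noise integrated first: translation by theta turns the noise integral into one
    over y, and integrating over theta then yields the convolution from the continuous part and [g]
    from the atom. *)
Lemma integral_signal_noise_law mu f F :
  measurable_fun [set: R] F -> (forall x, 0 <= F x)%E ->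
  (\int[signal_noise_law sigma mu f]_p F (p.1 + p.2)%R =
   \int[leb]_y (F y * (observation_pdf mu f y)%:E))%E.
Proof.
move=> mF F0.
have mg : measurable_fun [set: R] (fun x => (g x)%:E).
  by apply/measurable_EFinP; exact: measurable_normal_pdf.
have mf : measurable_fun [set: R] (fun x => (f x)%:E).
  by apply/measurable_EFinP; exact: measurable_pdf.
have mFD : measurable_fun [set: R * R] (fun p : R * R => F (p.1 + p.2)).
  by apply: (measurableT_comp mF); exact: measurable_funD.
have mFg : measurable_fun [set: R * R] (fun p : R * R => F p.2 * (g (p.2 - p.1))%:E)%E.
  apply: emeasurable_funM; first exact: (measurableT_comp mF).
  by apply: (measurableT_comp mg); exact: measurable_funB.
have Fg0 x y : (0 <= F x * (g y)%:E)%E by rewrite mule_ge0// lee_fin normal_pdf_ge0.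
rewrite /signal_noise_law fubini_tonelli1//= /fubini_F/=.
have inner theta : (\int[normal_prob 0 sigma]_xi F (theta + xi)%R =
    \int[leb]_y (F y * (g (y - theta))%:E))%E.
  rewrite (@integral_normal_prob (fun xi => F (theta + xi)%R)); last 2 first.
  - exact: (measurableT_comp mFD (pair1_measurable theta)).
  - by move=> xi; exact: F0.
  rewrite -(@ge0_integral_shift _ theta (fun y => F y * (g (y - theta))%:E)%E).
  - by apply: eq_integral => y _; rewrite addrAC subrr add0r.
  - exact: (measurableT_comp mFg (pair1_measurable theta)).
  - by move=> y; exact: Fg0.
under eq_integral do rewrite inner.
rewrite integral_theta_law; last 2 first.
- exact: (measurable_fun_fubini_tonelli_F (m2 := leb) _ mFg).
- by move=> x; apply: integral_ge0.
(* Continuous part: once the integrals are exchanged, the inner one is the convolution. *)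
have -> : (\int[leb]_theta (\int[leb]_y (F y * (g (y - theta))%:E) * (f theta)%:E) =
    \int[leb]_y (F y * (convolution f y)%:E))%E.
  transitivity (\int[leb]_theta \int[leb]_y (F y * (g (y - theta) * f theta)%:E))%E.
    apply: eq_integral => theta _; rewrite -ge0_integralZr//.
    - by apply: eq_integral => y _; rewrite EFinM muleA.
    - exact: (measurableT_comp mFg (pair1_measurable theta)).
    - by rewrite lee_fin pdf_ge0.
  rewrite (fubini_tonelli (m1 := leb) (m2 := leb)
    (fun p : R * R => F p.2 * (g (p.2 - p.1) * f p.1)%:E)%E)//=.
  - apply: eq_integral => y _; rewrite -convolutionE ge0_integralZl//.
    + exact: (measurableT_comp (measurable_kernel f) (pair1_measurable y)).
    + by move=> x _; rewrite lee_fin kernel_ge0.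
  - apply: emeasurable_funM; first exact: (measurableT_comp mF).
    apply: (@measurableT_comp _ _ _ _ _ _ _ _ (@unstable.swap R R) (measurable_kernel f)).
    exact: measurable_swap.
  - by move=> x; rewrite mule_ge0// lee_fin kernel_ge0.
have mFc : measurable_fun [set: R] (fun y => F y * (convolution f y)%:E)%E.
  by apply: emeasurable_funM => //; apply/measurable_EFinP; exact: measurable_convolution.
have Fc0 y : (0 <= F y * (convolution f y)%:E)%E.
  by rewrite mule_ge0// lee_fin convolution_ge0.
have m1 : 0 <= 1 - mu%:num by rewrite subr_ge0.
have mFg' : measurable_fun [set: R] (fun y => F y * (g y)%:E)%E.
  exact: emeasurable_funM.
(* Atom part: the kernel is evaluated at theta = 0. *)
under [X in (_ + _ * X)%E]eq_integral do rewrite subr0.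
rewrite -!ge0_integralZl// -ge0_integralD//.
- apply: eq_integral => y _.
  rewrite /observation_pdf [in RHS]EFinD ge0_muleDr ?lee_fin ?mulr_ge0
    ?convolution_ge0 ?normal_pdf_ge0//.
  by congr (_ + _)%E; rewrite [in RHS]EFinM muleCA.
- by move=> y _; rewrite mule_ge0// lee_fin.
- exact: measurable_funeM.
- by move=> y _; rewrite mule_ge0// lee_fin.
- exact: measurable_funeM.
Qed.

Lemma integral_observation_pdf mu f :
  (\int[leb]_y (observation_pdf mu f y)%:E = 1)%E.
Proof.
transitivity (\int[signal_noise_law sigma mu f]_p cst 1 (p.1 + p.2)%R)%E.
  rewrite integral_signal_noise_law//.
  by apply: eq_integral => y _; rewrite mul1e.
rewrite integral_cst// mul1e; exact: probability_setT.
Qed.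

End observation_density.

(** * Products of i.i.d. draws and their likelihoods *)

Section iid_likelihood.
Context d d' (T : measurableType d) (U : measurableType d') (R : realType).
Local Open Scope ereal_scope.

Lemma measurable_prod_tnth (a : T -> R) n : measurable_fun [set: T] a ->
  measurable_fun [set: n.-tuple T] (fun w => \prod_(i < n) a (tnth w i))%R.
Proof.
move=> ma; apply: measurable_prod => i _.
exact: (measurableT_comp ma (measurable_tnth i)).
Qed.

Lemma prod_tnth_cons (a : T -> R) n (x : T) (w : n.-tuple T) :
  (\prod_(i < n.+1) a (tnth (tuple_cons (x, w)) i) =
   a x * \prod_(i < n) a (tnth w i))%R.
Proof.
by rewrite big_ord_recl tnth0; congr (_ * _)%R; apply: eq_bigr => i _; rewrite tnthS.
Qed.

(** Tonelli for the product that defines [iid]; the integral computations by induction on the sample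
    size go through this identity. *)
Lemma ge0_integral_iidS (P : probability T R) n (F : n.+1.-tuple T -> \bar R) :
  measurable_fun [set: n.+1.-tuple T] F -> (forall w, 0 <= F w) ->
  \int[iid P n.+1]_w F w = \int[P]_x \int[iid P n]_w F (tuple_cons (x, w)).
Proof.
move=> mF F0; rewrite [LHS]ge0_integral_distribution//.
rewrite fubini_tonelli1//=.
exact: (measurableT_comp mF (@measurable_tuple_cons _ _ n)).
Qed.

(** Independence factors the expectation of a product. For the squared likelihood ratio this reduces
    the second moment to that of a single observation. *)
Lemma integral_iid_prod (P : probability T R) n (a : T -> R) :
  measurable_fun [set: T] a -> (forall x, 0 <= a x)%R ->
  \int[iid P n]_w (\prod_(i < n) a (tnth w i))%:E = (\int[P]_x (a x)%:E) ^+ n.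
Proof.
move=> ma a0; elim: n => [|n IHn].
  rewrite integral_dirac//= ?diracT ?mul1e ?big_ord0 ?expe0//.
  by apply/measurable_EFinP; exact: measurable_prod_tnth.
have prod0 m (w : m.-tuple T) : (0 <= (\prod_(i < m) a (tnth w i))%:E).
  by rewrite lee_fin prodr_ge0.
have mprod m : measurable_fun [set: m.-tuple T]
    (fun w => (\prod_(i < m) a (tnth w i))%:E).
  by apply/measurable_EFinP; exact: measurable_prod_tnth.
rewrite ge0_integral_iidS//.
under eq_integral => x _.
  under eq_integral do rewrite prod_tnth_cons EFinM.
  rewrite ge0_integralZl//; [|exact: mprod|by rewrite lee_fin].
  over.
rewrite ge0_integralZr//.
- by rewrite IHn expeS.
- exact/measurable_EFinP.
- by move=> x _; rewrite lee_fin.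
- by apply: integral_ge0 => w _.
Qed.

Variables (X : T -> U) (mX : measurable_fun [set: T] X).

(** With [X] the sum of signal and noise this is [observations] up to conversion, so the change of
    measure can be proved for an abstract observation map. *)
Definition map_observation {n} (w : n.-tuple T) : n.-tuple U :=
  [tuple X (tnth w i) | i < n].

Lemma map_observation_cons n (x : T) (w : n.-tuple T) :
  map_observation (tuple_cons (x, w)) = tuple_cons (X x, map_observation w).
Proof.
apply: eq_from_tnth => i; rewrite tnth_mktuple.
by case: (unliftP ord0 i) => [j|] ->; rewrite ?tnth0// !tnthS tnth_mktuple.
Qed.

Lemma measurable_map_observation n :
  measurable_fun [set: n.-tuple T] (map_observation (n := n)).
Proof.
apply/measurable_fun_tnthP => i.
rewrite (_ : _ \o _ = X \o (fun w => tnth w i)); last first.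
  by apply/funext => w /=; rewrite tnth_mktuple.
exact: (measurableT_comp mX (measurable_tnth i)).
Qed.

Definition likelihood (l : U -> R) {n} (y : n.-tuple U) : R :=
  (\prod_(i < n) l (tnth y i))%R.

Lemma likelihood_ge0 (l : U -> R) n (y : n.-tuple U) :
  (forall u, (0 <= l u)%R) -> (0 <= likelihood l y)%R.
Proof. by move=> l0; exact: prodr_ge0. Qed.

End iid_likelihood.

(** * Change of measure and the two-point inequality *)

Section iid_change_of_measure.
Context d d' (T : measurableType d) (U : measurableType d') (R : realType).
Variables (X : T -> U) (mX : measurable_fun [set: T] X).
Variables (P0 P1 : probability T R) (l : U -> R).
Local Open Scope ereal_scope.
Hypotheses (measurable_l : measurable_fun [set: U] l) (l_ge0 : forall u, (0 <= l u)%R)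
  (likelihood_l : forall F : U -> \bar R, measurable_fun [set: U] F ->
    (forall u, 0 <= F u) ->
    \int[P1]_x F (X x) = \int[P0]_x (F (X x) * (l (X x))%:E)).

Lemma measurable_likelihood n : measurable_fun [set: n.-tuple U] (likelihood l (n := n)).
Proof. exact: measurable_prod_tnth. Qed.

(** Induction on [n]: with the first draw fixed, the induction hypothesis changes the law of the
    others, then [likelihood_l] changes the law of the first. The integrands depend on the
    observations alone, because [l] compares the laws of [X] and not those of the hidden draws. *)
Lemma ge0_integral_iid_likelihood n (F : n.-tuple U -> \bar R) :
  measurable_fun [set: n.-tuple U] F -> (forall y, 0 <= F y) ->
  \int[iid P1 n]_w F (map_observation X w) =
  \int[iid P0 n]_w (F (map_observation X w) * (likelihood l (map_observation X w))%:E).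
Proof.
have mlik m : measurable_fun [set: m.-tuple U]
    (fun y => (likelihood l y)%:E).
  by apply/measurable_EFinP; exact: measurable_likelihood.
have lik0 m (y : m.-tuple U) : 0 <= (likelihood l y)%:E.
  by rewrite lee_fin likelihood_ge0.
elim: n F => [|n IHn] F mF F0.
  rewrite !integral_dirac//.
  - by rewrite /likelihood big_ord0 mule1.
  - apply: (measurableT_comp (emeasurable_funM mF (mlik _))).
    exact: measurable_map_observation.
  - by apply: (measurableT_comp mF); exact: measurable_map_observation.
have mFX : measurable_fun [set: n.+1.-tuple T] (fun w => F (map_observation X w)).
  by apply: (measurableT_comp mF); exact: measurable_map_observation.
have mlikX : measurable_fun [set: n.+1.-tuple T]
    (fun w => (likelihood l (map_observation X w))%:E).
  by apply: (measurableT_comp (mlik _)); exact: measurable_map_observation.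
rewrite !ge0_integral_iidS//; last 2 first.
- exact: emeasurable_funM.
- by move=> w; rewrite mule_ge0.
(* [H] takes the first observation, not the first draw, since [likelihood_l] applies only to
   functions of [X x]. *)
pose H (p : U * n.-tuple T) := F (tuple_cons (p.1, map_observation X p.2)) *
  (likelihood l (map_observation X p.2))%:E.
have mobs : measurable_fun [set: n.-tuple T] (map_observation X (n := n)).
  exact: measurable_map_observation.
have mcons : measurable_fun [set: U * n.-tuple T]
    (fun p => tuple_cons (p.1, map_observation X p.2)).
  apply: (measurable_cons measurable_fst).
  exact: (measurableT_comp mobs).
have mH : measurable_fun [set: U * n.-tuple T] H.
  apply: emeasurable_funM; first exact: (measurableT_comp mF mcons).
  apply: (measurableT_comp (mlik n)).
  exact: (measurableT_comp mobs).
have H0 p : 0 <= H p by rewrite mule_ge0.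
transitivity (\int[P1]_x fubini_F (iid P0 n) H (X x)).
  apply: eq_integral => x _.
  under eq_integral do rewrite map_observation_cons.
  rewrite (IHn (fun y => F (tuple_cons (X x, y))))//.
  apply: (measurableT_comp mF).
  exact: (measurableT_comp (@measurable_tuple_cons _ _ n) (pair1_measurable (X x))).
rewrite likelihood_l; last 2 first.
- exact: measurable_fun_fubini_tonelli_F.
- by move=> u; apply: integral_ge0.
apply: eq_integral => x _; rewrite -ge0_integralZr//.
- apply: eq_integral => w _; rewrite map_observation_cons /H/=.
  by rewrite -muleA -EFinM /likelihood prod_tnth_cons mulrC.
- exact: (measurableT_comp mH (pair1_measurable (X x))).
- by rewrite lee_fin.
Qed.

(* A mean squared error under each law adds up to at least (c0 - c1)^2 times the
   P0-mean of L / (1 + L), where L is the likelihood ratio; the minorant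
   L / (1 + L) >= 2 t L - t^2 L (1 + L) reduces it to the first two moments of L. *)
Lemma two_point_lower_bound n (est : n.-tuple U -> R) (c0 c1 M : R) :
  measurable_fun [set: n.-tuple U] est -> (0 <= M)%R ->
  (\int[P0]_x (l (X x) ^+ 2)%:E) ^+ n <= M%:E ->
  ((c0 - c1) ^+ 2 / (1 + M))%:E <=
    \int[iid P0 n]_w ((est (map_observation X w) - c0) ^+ 2)%:E +
    \int[iid P1 n]_w ((est (map_observation X w) - c1) ^+ 2)%:E.
Proof.
move=> mest M0 momentM.
have mobs : measurable_fun [set: n.-tuple T] (map_observation X (n := n)).
  exact: measurable_map_observation.
pose L w := likelihood l (map_observation X (n := n) w).
pose sq c w := ((est (map_observation X (n := n) w) - c) ^+ 2)%R.
have mL : measurable_fun [set: n.-tuple T] L.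
  by apply: (measurableT_comp _ mobs); exact: measurable_likelihood.
have L0 w : (0 <= L w)%R by exact: likelihood_ge0.
have msqy c : measurable_fun [set: n.-tuple U] (fun y => (est y - c) ^+ 2)%R.
  by apply: measurable_funX; exact: measurable_funB.
have msq c : measurable_fun [set: n.-tuple T] (sq c).
  exact: (measurableT_comp (msqy c) mobs).
have sq0 c w : (0 <= sq c w)%R by exact: sqr_ge0.
have intL : \int[iid P0 n]_w (L w)%:E = 1.
  transitivity (\int[iid P1 n]_w cst 1 (map_observation X w)).
    rewrite (@ge0_integral_iid_likelihood n (cst 1))//.
    by apply: eq_integral => w _; rewrite mul1e.
  by rewrite integral_cst// mul1e; exact: probability_setT.
have intL2 : \int[iid P0 n]_w (L w ^+ 2)%:E <= M%:E.
  apply: le_trans momentM; rewrite -integral_iid_prod//; last 2 first.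
  - by apply: measurable_funX; exact: (measurableT_comp measurable_l mX).
  - by move=> x; exact: sqr_ge0.
  rewrite le_eqVlt; apply/orP; left; apply/eqP; apply: eq_integral => w _.
  congr (_%:E); rewrite /L /likelihood -prodrXl.
  by apply: eq_bigr => i _; rewrite tnth_mktuple.
have -> : \int[iid P1 n]_w ((est (map_observation X w) - c1) ^+ 2)%:E =
    \int[iid P0 n]_w (sq c1 w * L w)%:E.
  rewrite (@ge0_integral_iid_likelihood n (fun y => ((est y - c1) ^+ 2)%:E))//.
  - exact/measurable_EFinP.
  - by move=> y; rewrite lee_fin sqr_ge0.
rewrite -/(\int[iid P0 n]_w (sq c0 w)%:E).
(* With mean 1 and second moment at most [M] for [L], the minorant integrates to at least [D] times
   2t - t^2 (1 + M); this [t] maximizes that expression, with value 1 / (1 + M). *)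
set D := ((c0 - c1) ^+ 2)%R; set t := ((1 + M)^-1)%R.
have D0 : (0 <= D)%R by exact: sqr_ge0.
have t0 : (0 <= t)%R by rewrite invr_ge0 addr_ge0.
have Dt0 : (0 <= D * t ^+ 2)%R by rewrite mulr_ge0// sqr_ge0.
have pointwise w : (2 * t * D * L w <=
    sq c0 w + sq c1 w * L w + D * t ^+ 2 * (L w + L w ^+ 2))%R.
  rewrite /D /sq; have := L0 w; move: (L w) (est _) => L' e L'0.
  have L1 : (0 < 1 + L')%R by rewrite ltr_pwDl.
  rewrite -subr_ge0.
  (* The first square is the distance of [e] from the weighted mean (c0 + c1 L) / (1 + L), which
     minimizes the combined error; the second is the gap in the minorant of L / (1 + L). *)
  have -> : ((e - c0) ^+ 2 + (e - c1) ^+ 2 * L' +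
      (c0 - c1) ^+ 2 * t ^+ 2 * (L' + L' ^+ 2) - 2 * t * (c0 - c1) ^+ 2 * L' =
    ((e - c0 + (e - c1) * L') ^+ 2 + L' * (c0 - c1) ^+ 2 * (1 - t * (1 + L')) ^+ 2) / (1 + L'))%R.
    field; lra.
  rewrite divr_ge0 ?(ltW L1)// addr_ge0 ?sqr_ge0//.
  by apply: mulr_ge0; rewrite ?sqr_ge0// mulr_ge0 ?sqr_ge0.
have EFm (h : n.-tuple T -> R) : measurable_fun [set: n.-tuple T] h ->
  measurable_fun [set: n.-tuple T] (fun w => (h w)%:E) by move=> ?; exact/measurable_EFinP.
have EF0 (h : n.-tuple T -> R) : (forall w, 0 <= h w)%R ->
  forall w, [set: n.-tuple T] w -> 0 <= (h w)%:E by move=> h0 w _; rewrite lee_fin.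
have msL : measurable_fun [set: n.-tuple T] (fun w => sq c1 w * L w)%R.
  exact: measurable_funM.
have mL2 : measurable_fun [set: n.-tuple T] (fun w => L w ^+ 2)%R.
  exact: measurable_funX.
have mLL : measurable_fun [set: n.-tuple T] (fun w => L w + L w ^+ 2)%R.
  exact: measurable_funD.
have mDLL : measurable_fun [set: n.-tuple T]
    (fun w => D * t ^+ 2 * (L w + L w ^+ 2))%R by exact: measurable_funM.
have mss : measurable_fun [set: n.-tuple T] (fun w => sq c0 w + sq c1 w * L w)%R.
  exact: measurable_funD.
have LL0 w : (0 <= L w + L w ^+ 2)%R by rewrite addr_ge0 ?sqr_ge0.
have sL0 w : (0 <= sq c1 w * L w)%R by rewrite mulr_ge0.
have tD0 : (0 <= 2 * t * D)%R by apply: mulr_ge0 => //; apply: mulr_ge0.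
have : \int[iid P0 n]_w (2 * t * D * L w)%:E <= \int[iid P0 n]_w
    (sq c0 w + sq c1 w * L w + D * t ^+ 2 * (L w + L w ^+ 2))%:E.
  apply: ge0_le_integral => //.
  - by move=> w _; rewrite lee_fin mulr_ge0.
  - by apply: EFm; exact: measurable_funM.
  - by apply: EFm; exact: measurable_funD.
  - by move=> w _; rewrite lee_fin.
have -> : \int[iid P0 n]_w (2 * t * D * L w)%:E = (2 * t * D)%:E.
  under eq_integral do rewrite EFinM.
  rewrite ge0_integralZl//; [by rewrite intL mule1|exact: EFm|exact: EF0].
have -> : \int[iid P0 n]_w
    (sq c0 w + sq c1 w * L w + D * t ^+ 2 * (L w + L w ^+ 2))%:E =
  \int[iid P0 n]_w (sq c0 w)%:E + \int[iid P0 n]_w (sq c1 w * L w)%:E +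
  (D * t ^+ 2)%:E * (1 + \int[iid P0 n]_w (L w ^+ 2)%:E).
  under eq_integral do rewrite EFinD.
  rewrite ge0_integralD//; last 4 first.
  - by move=> w _; rewrite lee_fin addr_ge0.
  - exact: EFm.
  - by move=> w _; rewrite lee_fin mulr_ge0.
  - exact: EFm.
  congr (_ + _).
    under eq_integral do rewrite EFinD.
    by rewrite ge0_integralD//; [exact: EF0|exact: EFm|exact: EF0|exact: EFm].
  under eq_integral do rewrite EFinM.
  rewrite ge0_integralZl//; [|exact: EFm|exact: EF0].
  congr (_ * _); rewrite -intL -ge0_integralD//.
  - exact: EF0.
  - exact: EFm.
  - by move=> w _; rewrite lee_fin sqr_ge0.
  - exact: EFm.
set S := (X in _ <= X + _ -> _) => le_tD.
have {}le_tD : (2 * t * D)%:E <= S + (D * t)%:E.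
  apply: le_trans le_tD _; rewrite leeD2l//.
  apply: (@le_trans _ _ ((D * t ^+ 2)%:E * (1 + M)%:E)).
    by rewrite lee_wpmul2l ?lee_fin// EFinD leeD2l.
  rewrite -EFinM lee_fin (_ : (D * t ^+ 2 * (1 + M) = D * t)%R)// /t.
  by field; lra.
rewrite -(leeD2rE _ _ (x := (D * t)%:E))//.
by apply: le_trans le_tD; rewrite -EFinD lee_fin; lra.
Qed.

End iid_change_of_measure.

(** On nonnegative reals inversion is the power with exponent -1, a measurable function; at 0 both
    take the default value 0. *)
Lemma ge0_measurable_funV d (T : measurableType d) (R : realType) (h : T -> R) :
  measurable_fun [set: T] h -> (forall x, 0 <= h x) ->
  measurable_fun [set: T] (fun x => (h x)^-1).
Proof.
move=> mh h0; rewrite (_ : (fun _ => _) = (@powR R ^~ (-1)) \o h); last first.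
  by apply/funext => x; rewrite /= powR_inv1.
exact: measurableT_comp.
Qed.

(** * Mixtures of two densities *)

Section mixture.
Context {R : realType}.
Local Notation leb := (@lebesgue_measure R).
Implicit Types (t : {i01 R}) (f : pdf R).

Lemma onem_i01_ge0 t : 0 <= 1 - t%:num :> R.
Proof. by rewrite subr_ge0. Qed.

Definition mixture_fun t f1 f2 (x : R) : R :=
  t%:num * f1 x + (1 - t%:num) * f2 x.

Lemma measurable_mixture t f1 f2 :
  measurable_fun [set: R] (mixture_fun t f1 f2).
Proof.
by apply: measurable_funD; apply: measurable_funM => //; exact: measurable_pdf.
Qed.

Lemma mixture_ge0 t f1 f2 x : 0 <= mixture_fun t f1 f2 x.
Proof. by rewrite addr_ge0// mulr_ge0 ?pdf_ge0 ?onem_i01_ge0. Qed.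

(** Stated for nonnegative functions rather than densities, so as to serve also for convolution
    kernels and energies. *)
Lemma ge0_integral_mixture t (p1 p2 : R -> R) :
  measurable_fun [set: R] p1 -> measurable_fun [set: R] p2 ->
  (forall x, 0 <= p1 x) -> (forall x, 0 <= p2 x) ->
  (\int[leb]_x (t%:num * p1 x + (1 - t%:num) * p2 x)%:E =
   t%:num%:E * \int[leb]_x (p1 x)%:E + (1 - t%:num)%:E * \int[leb]_x (p2 x)%:E)%E.
Proof.
move=> mp1 mp2 p10 p20.
have EFm (h : R -> R) : measurable_fun [set: R] h ->
  measurable_fun [set: R] (fun x => (h x)%:E) by move=> ?; exact/measurable_EFinP.
under eq_integral do rewrite EFinD.
rewrite ge0_integralD//.
- under eq_integral do rewrite EFinM.
  rewrite ge0_integralZl//; [|exact: EFm|by move=> x _; rewrite lee_fin].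
  under [X in (_ + X = _)%E]eq_integral do rewrite EFinM.
  by rewrite ge0_integralZl ?lee_fin ?onem_i01_ge0//;
    [exact: EFm|move=> x _; rewrite lee_fin].
- by move=> x _; rewrite lee_fin mulr_ge0.
- by apply: EFm; exact: measurable_funM.
- by move=> x _; rewrite lee_fin mulr_ge0 ?onem_i01_ge0.
- by apply: EFm; exact: measurable_funM.
Qed.

Lemma integral_mixture t f1 f2 :
  (\int[leb]_x (mixture_fun t f1 f2 x)%:E = 1)%E.
Proof.
rewrite ge0_integral_mixture ?integral_pdf ?mule1; last 4 first.
- exact: measurable_pdf.
- exact: measurable_pdf.
- exact: pdf_ge0.
- exact: pdf_ge0.
by rewrite -EFinD addrC subrK.
Qed.

Definition mixture t f1 f2 : pdf R :=
  Pdf (measurable_mixture t f1 f2) (mixture_ge0 t f1 f2) (integral_mixture t f1 f2).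

Lemma integrable_mixture (phi : R -> R) t f1 f2 :
  leb.-integrable [set: R] (fun x => (phi x * f1 x)%:E) ->
  leb.-integrable [set: R] (fun x => (phi x * f2 x)%:E) ->
  leb.-integrable [set: R] (fun x => (phi x * mixture t f1 f2 x)%:E).
Proof.
move=> i1 i2.
rewrite (_ : (fun _ => _) = (fun x => t%:num%:E * (phi x * f1 x)%:E +
    (1 - t%:num)%:E * (phi x * f2 x)%:E)%E); last first.
  by apply/funext => x; rewrite -!EFinM -EFinD /= /mixture_fun; congr (_%:E); ring.
by apply: integrableD => //; exact: integrableZl.
Qed.

Lemma functional_mixture (phi : R -> R) t f1 f2 :
  leb.-integrable [set: R] (fun x => (phi x * f1 x)%:E) ->
  leb.-integrable [set: R] (fun x => (phi x * f2 x)%:E) ->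
  functional phi (mixture t f1 f2) =
  t%:num * functional phi f1 + (1 - t%:num) * functional phi f2.
Proof.
move=> i1 i2; rewrite /functional -RintegralZl// -RintegralZl// -RintegralD//.
- by apply: eq_Rintegral => x _; rewrite /= /mixture_fun; ring.
- exact: (integrableZl measurableT t%:num i1).
- exact: (integrableZl measurableT (1 - t%:num) i2).
Qed.

End mixture.

(** * Convolution and energy of a mixture *)

Section candidate_mixture.
Context {R : realType} (sigma : R) (sigma_neq0 : sigma != 0).
Local Notation leb := (@lebesgue_measure R).
Local Notation g := (normal_pdf 0 sigma).
Implicit Types (t mu : {i01 R}) (f : pdf R).

Lemma convolution_mixture t f1 f2 x :
  convolution sigma (mixture t f1 f2) x =
  t%:num * convolution sigma f1 x + (1 - t%:num) * convolution sigma f2 x.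
Proof.
apply: EFin_inj; rewrite -(convolutionE sigma_neq0).
have mk f : measurable_fun [set: R] (fun y => g (x - y) * f y).
  apply/measurable_EFinP.
  exact: (measurableT_comp (measurable_kernel sigma f) (pair1_measurable x)).
under eq_integral => y _.
  rewrite (_ : _ * _ = t%:num * (g (x - y) * f1 y) +
    (1 - t%:num) * (g (x - y) * f2 y)); last by rewrite /= /mixture_fun; ring.
  over.
rewrite ge0_integral_mixture//; [|by move=> y; exact: kernel_ge0..].
by rewrite !convolutionE.
Qed.

(** The observation density with [mu] equal to 1, where the atom carries no mass. *)
Lemma integral_convolution f : (\int[leb]_x (convolution sigma f x)%:E = 1)%E.
Proof.
rewrite -(integral_observation_pdf sigma_neq0 (1%:i01) f).
by apply: eq_integral => x _; rewrite /observation_pdf/= mul1r subrr mul0r addr0.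
Qed.

Lemma inverse_weighted_energyE f : inverse_weighted_energy sigma f =
  (\int[leb]_x ((g x)^-1 * convolution sigma f x ^+ 2)%:E)%E.
Proof. by apply: eq_integral => x _; rewrite convolutionE. Qed.

Lemma energy_ge0 f x : 0 <= (g x)^-1 * convolution sigma f x ^+ 2.
Proof. by rewrite mulr_ge0 ?sqr_ge0// invr_ge0 normal_pdf_ge0. Qed.

Lemma measurable_energy f :
  measurable_fun [set: R] (fun x => (g x)^-1 * convolution sigma f x ^+ 2).
Proof.
apply: measurable_funM.
  apply: ge0_measurable_funV; first exact: measurable_normal_pdf.
  exact: normal_pdf_ge0.
by apply: measurable_funX; exact: measurable_convolution.
Qed.

(** The energy is convex in the density: it integrates, with nonnegative weight 1/g, the square of
    the convolution, which is linear in the density. *)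
Lemma inverse_weighted_energy_mixture t f1 f2 (C : R) :
  (inverse_weighted_energy sigma f1 <= C%:E)%E ->
  (inverse_weighted_energy sigma f2 <= C%:E)%E ->
  (inverse_weighted_energy sigma (mixture t f1 f2) <= C%:E)%E.
Proof.
rewrite !inverse_weighted_energyE => E1 E2.
apply: (@le_trans _ _ (t%:num%:E * C%:E + (1 - t%:num)%:E * C%:E)%E); last first.
  by rewrite -!EFinM -EFinD lee_fin -mulrDl addrC subrK mul1r.
apply: (@le_trans _ _ (\int[leb]_x (t%:num * ((g x)^-1 * convolution sigma f1 x ^+ 2) +
    (1 - t%:num) * ((g x)^-1 * convolution sigma f2 x ^+ 2))%:E)%E).
  apply: ge0_le_integral => //.
  - by move=> x _; rewrite lee_fin energy_ge0.
  - by apply/measurable_EFinP; exact: measurable_energy.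
  - apply/measurable_EFinP; apply: measurable_funD; apply: measurable_funM => //;
      exact: measurable_energy.
  - move=> x _; rewrite lee_fin convolution_mixture.
    have g0 : 0 <= (g x)^-1 by rewrite invr_ge0 normal_pdf_ge0.
    rewrite !(mulrCA _ (g x)^-1) -mulrDr ler_wpM2l// -subr_ge0.
    (* The exact gap in the convexity inequality for the square. *)
    rewrite (_ : _ - _ = t%:num * (1 - t%:num) *
      (convolution sigma f1 x - convolution sigma f2 x) ^+ 2); last by ring.
    by rewrite mulr_ge0 ?sqr_ge0// mulr_ge0// onem_i01_ge0.
rewrite ge0_integral_mixture//;
  [|exact: measurable_energy|exact: measurable_energy|exact: energy_ge0|exact: energy_ge0].
by apply: leeD; (apply: lee_wpmul2l; first by rewrite lee_fin ?onem_i01_ge0);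
  [exact: E1|exact: E2].
Qed.

End candidate_mixture.

(** * Pointwise chi-square inequality *)

Section chi_square.
Context {R : realType}.

(* (he - h0)^2 / h0 is controlled by [g] when [mu <= 1/2] and by [p1 + p2]
   otherwise, so [mu] may approach or equal 1. *)
Lemma chi_square_pointwise (mu e p1 p2 g : R) :
  let h0 := mu * (2^-1 * p1 + (1 - 2^-1) * p2) + (1 - mu) * g in
  let he := mu * ((1 - e) / 2 * p1 + (1 - (1 - e) / 2) * p2) + (1 - mu) * g in
  0 < mu -> mu <= 1 -> 0 <= e -> e <= 1 -> 0 <= p1 -> 0 <= p2 -> 0 < g ->
  (he / h0) ^+ 2 * h0 + h0 <= 2 * he +
    (mu * e) ^+ 2 * (2^-1 * (g^-1 * p1 ^+ 2 + g^-1 * p2 ^+ 2) + (p1 + p2)).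
Proof.
move=> h0 he mu0 mu1 e0 e1 p10 p20 g0.
have h0_ge0 : 0 <= h0 by rewrite /h0; apply: addr_ge0; apply: mulr_ge0; lra.
have he_ge0 : 0 <= he.
  rewrite /he; apply: addr_ge0; apply: mulr_ge0; rewrite ?(ltW mu0) ?(ltW g0)//; last lra.
  by apply: addr_ge0; apply: mulr_ge0 => //; lra.
have gi0 : 0 <= g^-1 by rewrite invr_ge0 ltW.
have q1 : 0 <= g^-1 * p1 ^+ 2 by rewrite mulr_ge0// sqr_ge0.
have q2 : 0 <= g^-1 * p2 ^+ 2 by rewrite mulr_ge0// sqr_ge0.
(* If [h0] vanishes, the left side is 0 and only the nonnegativity of the right side matters. *)
have [h00|h0n] := eqVneq h0 0.
  rewrite h00 invr0 !mulr0 add0r addr_ge0// mulr_ge0 ?sqr_ge0//; lra.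
have h0p : 0 < h0 by rewrite lt_neqAle eq_sym h0n.
have heE : he = h0 + mu * e * ((p2 - p1) / 2) by rewrite /he /h0; field.
(* Moving 2 he to the left leaves (he - h0)^2 / h0, the chi-square integrand. *)
rewrite -lerBlDl.
have -> : (he / h0) ^+ 2 * h0 + h0 - 2 * he = (mu * e) ^+ 2 * (((p2 - p1) / 2) ^+ 2 / h0).
  by rewrite heE; field.
rewrite ler_wpM2l ?sqr_ge0// ler_pdivrMr//.
have [muh|muh] := lerP mu 2^-1.
- have h0g : 2^-1 * g <= h0.
    rewrite /h0 -[leLHS]add0r lerD//; first by apply: mulr_ge0; lra.
    by apply: ler_wpM2r; lra.
  apply: (@le_trans _ _ ((2^-1 * (g^-1 * p1 ^+ 2 + g^-1 * p2 ^+ 2)) * (2^-1 * g))).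
    rewrite (_ : _ * (2^-1 * g) = 2^-2 * (p1 ^+ 2 + p2 ^+ 2)); last by field; lra.
    nra.
  by apply: ler_pM => //; lra.
- have h0p12 : 4^-1 * (p1 + p2) <= h0.
    rewrite /h0 -[leLHS]addr0 lerD//; last by apply: mulr_ge0; lra.
    nra.
  apply: (@le_trans _ _ ((p1 + p2) * (4^-1 * (p1 + p2)))); first nra.
  by apply: ler_pM => //; lra.
Qed.

End chi_square.

(** * Risk of an estimator at two mixtures *)

Section two_point_risk.
Context {R : realType} (sigma : R) (sigma_neq0 : sigma != 0).
Local Notation leb := (@lebesgue_measure R).
Local Notation g := (normal_pdf 0 sigma).
Variables (phi : R -> R) (f1 f2 : pdf R) (C_I : R).
Hypotheses (energy1 : (inverse_weighted_energy sigma f1 <= C_I%:E)%E)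
  (energy2 : (inverse_weighted_energy sigma f2 <= C_I%:E)%E)
  (integrable1 : leb.-integrable [set: R] (fun x => (phi x * f1 x)%:E))
  (integrable2 : leb.-integrable [set: R] (fun x => (phi x * f2 x)%:E)).
Variables (mu t0 te : {i01 R}) (e : R).
Hypotheses (mu_gt0 : 0 < mu%:num) (e_ge0 : 0 <= e) (e_le1 : e <= 1)
  (t0E : t0%:num = 2^-1) (teE : te%:num = (1 - e) / 2).
Local Notation h0 := (observation_pdf sigma mu (mixture t0 f1 f2)).
Local Notation he := (observation_pdf sigma mu (mixture te f1 f2)).
Let l y : R := he y / h0 y.

Let measurable_l : measurable_fun [set: R] l.
Proof.
apply: measurable_funM; first exact: measurable_observation_pdf.
apply: ge0_measurable_funV; first exact: measurable_observation_pdf.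
exact: observation_pdf_ge0.
Qed.

Let l_ge0 y : 0 <= l y.
Proof. by rewrite divr_ge0// observation_pdf_ge0. Qed.

Let h0E y : h0 y = mu%:num * (2^-1 * convolution sigma f1 y +
  (1 - 2^-1) * convolution sigma f2 y) + (1 - mu%:num) * g y.
Proof. by rewrite /observation_pdf convolution_mixture// t0E. Qed.

Let heE y : he y = mu%:num * ((1 - e) / 2 * convolution sigma f1 y +
  (1 - (1 - e) / 2) * convolution sigma f2 y) + (1 - mu%:num) * g y.
Proof. by rewrite /observation_pdf convolution_mixture// teE. Qed.

(** Absolute continuity. [h0] puts positive weight on the nonnegative terms mu c1, mu c2 and (1 -
    mu) g, which [he] only reweights; so a zero of [h0] is a zero of [he], and the default quotient
    0 is right there. *)
Let lE y : l y * h0 y = he y.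
Proof.
rewrite /l; have [h00|h0n] := eqVneq (h0 y) 0; last by rewrite divfK.
rewrite h00 mulr0; move: h00; rewrite h0E heE.
have := convolution_ge0 sigma f1 y; have := convolution_ge0 sigma f2 y.
have g0 := normal_pdf_gt0 sigma_neq0 y.
move: (convolution _ _ _) (convolution _ _ _) => c2 c1 c20 c10 h00.
have mg : 0 <= (1 - mu%:num) * g y by rewrite mulr_ge0 ?onem_i01_ge0 ?(ltW g0).
have mc1 : 0 <= mu%:num * c1 by rewrite mulr_ge0.
have mc2 : 0 <= mu%:num * c2 by rewrite mulr_ge0.
have mc1' : mu%:num * c1 = 0 by lra.
have mc2' : mu%:num * c2 = 0 by lra.
have mg' : (1 - mu%:num) * g y = 0 by lra.
by rewrite mulrDr !(mulrCA mu%:num) mc1' mc2' mg' !mulr0 !addr0.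
Qed.

Let likelihood_l (F : R -> \bar R) :
  measurable_fun [set: R] F -> (forall y, 0 <= F y)%E ->
  (\int[signal_noise_law sigma mu (mixture te f1 f2)]_p F (p.1 + p.2)%R =
   \int[signal_noise_law sigma mu (mixture t0 f1 f2)]_p
     (F (p.1 + p.2)%R * (l (p.1 + p.2))%:E))%E.
Proof.
move=> mF F0; rewrite (integral_signal_noise_law sigma_neq0 _ _ mF F0).
have mFl : measurable_fun [set: R] (fun y => F y * (l y)%:E)%E.
  by apply: emeasurable_funM => //; exact/measurable_EFinP.
have Fl0 y : (0 <= F y * (l y)%:E)%E by rewrite mule_ge0// lee_fin.
rewrite (integral_signal_noise_law sigma_neq0 _ _ mFl Fl0).
by apply: eq_integral => y _; rewrite -muleA -EFinM lE.
Qed.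

Let mobs f :
  measurable_fun [set: R] (fun y => (observation_pdf sigma mu f y)%:E).
Proof. by apply/measurable_EFinP; exact: measurable_observation_pdf. Qed.

(** Integrates [chi_square_pointwise], using that [h0], [he] and the two convolutions have mass 1
    and that the energies are at most [C_I]. *)
Lemma chi_square_bound :
  (\int[signal_noise_law sigma mu (mixture t0 f1 f2)]_p
    (l (p.1 + p.2)%R ^+ 2)%:E <= (1 + (mu%:num * e) ^+ 2 * (C_I + 2))%:E)%E.
Proof.
have ml2 : measurable_fun [set: R] (fun y => (l y ^+ 2)%:E).
  by apply/measurable_EFinP; exact: measurable_funX.
have l20 y : (0 <= (l y ^+ 2)%:E)%E by rewrite lee_fin sqr_ge0.
rewrite (integral_signal_noise_law sigma_neq0 _ _ ml2 l20).
set I := (X in (X <= _)%E).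
have K0 : 0 <= (mu%:num * e) ^+ 2 by exact: sqr_ge0.
have mc f : measurable_fun [set: R] (fun y => (convolution sigma f y)%:E).
  by apply/measurable_EFinP; exact: measurable_convolution.
have mq f : measurable_fun [set: R]
    (fun y => ((g y)^-1 * convolution sigma f y ^+ 2)%:E).
  by apply/measurable_EFinP; exact: measurable_energy.
pose q y := ((2^-1)%:E * (((g y)^-1 * convolution sigma f1 y ^+ 2)%:E +
      ((g y)^-1 * convolution sigma f2 y ^+ 2)%:E) +
      ((convolution sigma f1 y)%:E + (convolution sigma f2 y)%:E))%E.
have c0 f y : (0 <= (convolution sigma f y)%:E)%E by rewrite lee_fin convolution_ge0.
have e0 f y : (0 <= ((g y)^-1 * convolution sigma f y ^+ 2)%:E)%E.
  by rewrite lee_fin energy_ge0.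
have o0 f y : (0 <= (observation_pdf sigma mu f y)%:E)%E.
  by rewrite lee_fin observation_pdf_ge0.
have ee0 y : (0 <= ((g y)^-1 * convolution sigma f1 y ^+ 2)%:E +
      ((g y)^-1 * convolution sigma f2 y ^+ 2)%:E)%E by exact: adde_ge0.
have mee : measurable_fun [set: R] (fun y => ((g y)^-1 * convolution sigma f1 y ^+ 2)%:E +
      ((g y)^-1 * convolution sigma f2 y ^+ 2)%:E)%E by exact: emeasurable_funD.
have q0 y : (0 <= q y)%E.
  by apply: adde_ge0; [exact: mule_ge0|exact: adde_ge0].
have mcc : measurable_fun [set: R]
    (fun y => (convolution sigma f1 y)%:E + (convolution sigma f2 y)%:E)%E.
  exact: emeasurable_funD.
have mqq : measurable_fun [set: R] q.
  by apply: emeasurable_funD => //; exact: measurable_funeM.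
have mlh : measurable_fun [set: R] (fun y => (l y ^+ 2)%:E * (h0 y)%:E)%E.
  by apply: emeasurable_funM; [exact: ml2|exact: mobs].
have lh0 y : [set: R] y -> (0 <= (l y ^+ 2)%:E * (h0 y)%:E)%E.
  by move=> _; rewrite mule_ge0.
(* The mass of [h0] is added on the left instead of 2 he being subtracted, so every integrand stays
   nonnegative. *)
have : (I + 1 <= 2%:E + ((mu%:num * e) ^+ 2)%:E * \int[leb]_y q y)%E.
  have -> : (I + 1 = \int[leb]_y ((l y ^+ 2)%:E * (h0 y)%:E + (h0 y)%:E))%E.
    rewrite ge0_integralD;
      [|exact: measurableT|exact: lh0|exact: mlh|by move=> y _; exact: o0|exact: mobs].
    by rewrite integral_observation_pdf.
  have -> : (2%:E = \int[leb]_y (2%:E * (he y)%:E))%E.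
    rewrite ge0_integralZl;
      [|exact: measurableT|exact: mobs|by move=> y _; exact: o0|by rewrite lee_fin].
    by rewrite integral_observation_pdf// mule1.
  rewrite -ge0_integralZl;
    [|exact: measurableT|exact: mqq|by move=> y _; exact: q0|by rewrite lee_fin].
  rewrite -ge0_integralD; last 5 first.
  - exact: measurableT.
  - by move=> y _; rewrite mule_ge0.
  - by apply: measurable_funeM; exact: mobs.
  - by move=> y _; rewrite mule_ge0// lee_fin.
  - exact: measurable_funeM.
  apply: ge0_le_integral.
  - exact: measurableT.
  - by move=> y _; apply: adde_ge0; [exact: lh0|exact: o0].
  - by apply: emeasurable_funD; [exact: mlh|exact: mobs].
  - by apply: emeasurable_funD; apply: measurable_funeM => //; exact: mobs.
  - move=> y _; rewrite -!(EFinM, EFinD) lee_fin /l heE h0E.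
    apply: chi_square_pointwise => //; rewrite ?convolution_ge0//.
    exact: normal_pdf_gt0.
have Iq : (\int[leb]_y q y <= (C_I + 2)%:E)%E.
  rewrite ge0_integralD; last 5 first.
  - exact: measurableT.
  - by move=> y _; exact: mule_ge0.
  - exact: measurable_funeM.
  - by move=> y _; exact: adde_ge0.
  - exact: mcc.
  rewrite EFinD; apply: leeD.
    rewrite ge0_integralZl;
      [|exact: measurableT|exact: mee|by move=> y _; exact: ee0|by rewrite lee_fin].
    rewrite ge0_integralD; last 5 first.
    - exact: measurableT.
    - by move=> y _; exact: e0.
    - exact: mq.
    - by move=> y _; exact: e0.
    - exact: mq.
    rewrite -!inverse_weighted_energyE//.
    rewrite (_ : C_I%:E = (2^-1)%:E * (C_I%:E + C_I%:E))%E; last first.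
      by rewrite -EFinD -EFinM; congr (_%:E); lra.
    by apply: lee_wpmul2l; [rewrite lee_fin|apply: leeD; [exact: energy1|exact: energy2]].
  rewrite ge0_integralD; last 5 first.
  - exact: measurableT.
  - by move=> y _; exact: c0.
  - exact: mc.
  - by move=> y _; exact: c0.
  - exact: mc.
  by rewrite !integral_convolution.
move=> Ile; rewrite -(leeD2rE _ _ (x := 1%E))//.
apply: (le_trans Ile).
apply: (@le_trans _ _ (2%:E + ((mu%:num * e) ^+ 2)%:E * (C_I + 2)%:E)%E).
  by rewrite leeD2l// lee_wpmul2l.
by rewrite -EFinM -!EFinD lee_fin; lra.
Qed.

(** The two-point inequality with M = exp(C_I + 2). The factor [e / 2] is the difference 1/2 - (1 -
    e)/2 of the mixture weights. *)
Lemma two_point_risk n (est : n.-tuple (measurableTypeR R) -> R) :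
  measurable_fun [set: n.-tuple (measurableTypeR R)] est ->
  n%:R * (mu%:num * e) ^+ 2 <= 1 -> 0 <= C_I ->
  (((e / 2 * (functional phi f1 - functional phi f2)) ^+ 2 / (1 + expR (C_I + 2)))%:E <=
   risk sigma mu phi est (mixture t0 f1 f2) +
   risk sigma mu phi est (mixture te f1 f2))%E.
Proof.
move=> mest ne C0; rewrite /risk unlock.
have mX : measurable_fun [set: (measurableTypeR R * measurableTypeR R)%type]
    (fun p => p.1 + p.2).
  exact: measurable_funD.
have moment : ((\int[signal_noise_law sigma mu (mixture t0 f1 f2)]_p
    (l (p.1 + p.2)%R ^+ 2)%:E) ^+ n <= (expR (C_I + 2))%:E)%E.
  have := chi_square_bound; have : (0 <= \int[signal_noise_law sigma mu
      (mixture t0 f1 f2)]_p (l (p.1 + p.2)%R ^+ 2)%:E)%E.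
    by apply: integral_ge0 => p _; rewrite lee_fin sqr_ge0.
  case: (integral _ _ _) => [r| |]//; rewrite !lee_fin => r0 rle.
  rewrite -EFin_expe lee_fin.
  (* From 1 + x <= exp x; the n-th power then has exponent n (mu e)^2 (C_I + 2), at most C_I + 2 by
     [ne]. *)
  apply: (@le_trans _ _ (expR ((mu%:num * e) ^+ 2 * (C_I + 2)) ^+ n)).
    by rewrite lerXn2r ?nnegrE ?expR_ge0//; apply: le_trans rle _; exact: expR_ge1Dx.
  rewrite -expRM_natl ler_expR mulrA; apply: ler_piMl => //.
  by rewrite addr_ge0.
have := two_point_lower_bound mX measurable_l l_ge0 likelihood_l
  (functional phi (mixture t0 f1 f2)) (functional phi (mixture te f1 f2))
  mest (expR_ge0 _) moment.
rewrite !functional_mixture// t0E teE.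
rewrite (_ : _ - _ = e / 2 * (functional phi f1 - functional phi f2)); last by field.
exact.
Qed.

End two_point_risk.

Lemma centered_normal_pdfE (R : realType) (s x : R) : s != 0 ->
  normal_pdf 0 s x = normal_peak s * expR (- x ^+ 2 / (2 * s ^+ 2)).
Proof. by move=> s0; rewrite normal_pdfE//= /normal_fun subr0 mulr_natl. Qed.

(** * Uniform densities on sets of positive finite measure *)

Section uniform_on.
Context {R : realType}.
Local Notation leb := (@lebesgue_measure R).
Variable A : set R.
Hypotheses (measurable_A : measurable A) (A_gt0 : (0 < leb A)%E)
  (A_lty : (leb A < +oo)%E).

Definition uniform_on_fun (x : R) : R := (fine (leb A))^-1 * \1_A x.

Lemma fine_measure_gt0 : 0 < fine (leb A).
Proof. by rewrite fine_gt0// A_gt0. Qed.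

Lemma uniform_on_ge0 x : 0 <= uniform_on_fun x.
Proof. by rewrite mulr_ge0// invr_ge0 ltW// fine_measure_gt0. Qed.

Lemma measurable_uniform_on : measurable_fun [set: R] uniform_on_fun.
Proof. by apply: measurable_funM => //; exact: measurable_indic. Qed.

Lemma integral_uniform_on : (\int[leb]_x (uniform_on_fun x)%:E = 1)%E.
Proof.
under eq_integral do rewrite EFinM.
rewrite ge0_integralZl; last 4 first.
- exact: measurableT.
- by apply/measurable_EFinP; exact: measurable_indic.
- by move=> x _; rewrite lee_fin.
- by rewrite lee_fin invr_ge0 ltW// fine_measure_gt0.
rewrite integral_indic// setIT -[X in (_ * X)%E]fineK ?ge0_fin_numE//.
by rewrite -EFinM mulVf// gt_eqF// fine_measure_gt0.
Qed.

Definition uniform_on : pdf R :=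
  Pdf measurable_uniform_on uniform_on_ge0 integral_uniform_on.

End uniform_on.

(** * Energy and integrability for compactly supported densities *)

Section compactly_supported_candidates.
Context {R : realType} (sigma : R) (sigma_gt0 : 0 < sigma).
Local Notation leb := (@lebesgue_measure R).
Local Notation g := (normal_pdf 0 sigma).
Implicit Types (f : pdf R) (phi : R -> R) (m : R).

Let sigma_neq0 : sigma != 0. Proof. by rewrite gt_eqF. Qed.

(** The integrand is a multiple of the normal density of variance 2 sigma^2. *)
Lemma integral_gaussian_tail (K : R) : 0 <= K ->
  (\int[leb]_x (K * expR (- x ^+ 2 / (4 * sigma ^+ 2)))%:E =
   (K / normal_peak (Num.sqrt 2 * sigma))%:E)%E.
Proof.
move=> K0; set s := Num.sqrt 2 * sigma.
have s0 : s != 0 by rewrite gt_eqF// mulr_gt0// sqrtr_gt0.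
have peak0 := normal_peak_gt0 s0.
transitivity (\int[leb]_x ((K / normal_peak s)%:E * (normal_pdf 0 s x)%:E))%E.
  apply: eq_integral => x _; rewrite -EFinM centered_normal_pdfE//.
  rewrite (mulrA (K / _)) divfK ?gt_eqF//; congr (_ * expR (_ / _))%:E.
  by rewrite /s exprMn sqr_sqrtr//; ring.
rewrite ge0_integralZl; last 4 first.
- exact: measurableT.
- by apply/measurable_EFinP; exact: measurable_normal_pdf.
- by move=> x _; rewrite lee_fin normal_pdf_ge0.
- by rewrite lee_fin divr_ge0// ltW.
by rewrite integral_normal_pdf mule1.
Qed.

(* (x - theta)^2 >= 3/4 x^2 - 3 theta^2. *)
Lemma normal_pdf_shift_le m x theta : `|theta| <= m ->
  g (x - theta) <= normal_peak sigma *
    expR ((3 * m ^+ 2 - 3 / 4 * x ^+ 2) / (2 * sigma ^+ 2)).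
Proof.
move=> thetam; rewrite centered_normal_pdfE// ler_wpM2l ?normal_peak_ge0//.
rewrite ler_expR ler_wpM2r//.
  by rewrite invr_ge0 mulr_ge0// sqr_ge0.
have : theta ^+ 2 <= m ^+ 2.
  by rewrite -[theta ^+ 2]real_normK ?num_real// lerXn2r ?nnegrE// (le_trans _ thetam).
(* This square is exactly (x - theta)^2 - 3/4 x^2 + 3 theta^2. *)
have := sqr_ge0 (x / 2 - 2 * theta); nra.
Qed.

(** The integral of B^2 / g, where B is the bound of [normal_pdf_shift_le]: the exponents x^2 / (2
    sigma^2) and -3 x^2 / (4 sigma^2) add up to -x^2 / (4 sigma^2). *)
Definition compact_energy_bound m : R :=
  normal_peak sigma * expR (3 * m ^+ 2 / sigma ^+ 2) /
    normal_peak (Num.sqrt 2 * sigma).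

Lemma compact_energy_bound_gt0 m : 0 < compact_energy_bound m.
Proof.
rewrite divr_gt0 ?normal_peak_gt0//; last first.
  by rewrite gt_eqF// mulr_gt0// sqrtr_gt0.
by rewrite mulr_gt0 ?expR_gt0// normal_peak_gt0.
Qed.

(** Averaging the bound of [normal_pdf_shift_le] against [f] bounds the convolution by [B]. The
    coefficient 3/4 exceeds 1/2, so B^2 decays faster than [g] and the quotient is integrable. *)
Lemma compact_inverse_weighted_energy m f : (forall x, m < `|x| -> f x = 0) ->
  (inverse_weighted_energy sigma f <= (compact_energy_bound m)%:E)%E.
Proof.
move=> fm; rewrite inverse_weighted_energyE//.
rewrite -integral_gaussian_tail; last first.
  by rewrite mulr_ge0 ?normal_peak_ge0 ?expR_ge0.
apply: ge0_le_integral => //.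
- by move=> x _; rewrite lee_fin energy_ge0.
- by apply/measurable_EFinP; exact: measurable_energy.
- apply/measurable_EFinP; apply: measurable_funM => //.
  apply: measurableT_comp => //; apply: measurable_funM => //.
  by apply: measurableT_comp => //; exact: measurable_funX.
move=> x _; rewrite lee_fin.
set B := normal_peak sigma * expR ((3 * m ^+ 2 - 3 / 4 * x ^+ 2) / (2 * sigma ^+ 2)).
have B0 : 0 <= B by rewrite mulr_ge0 ?normal_peak_ge0 ?expR_ge0.
have cB : convolution sigma f x <= B.
  rewrite -lee_fin -convolutionE//.
  apply: (@le_trans _ _ (\int[leb]_theta (B%:E * (f theta)%:E))%E).
    apply: ge0_le_integral => //.
    - by move=> y _; rewrite lee_fin kernel_ge0.
    - exact: (measurableT_comp (measurable_kernel sigma f) (pair1_measurable x)).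
    - by apply: measurable_funeM; apply/measurable_EFinP; exact: measurable_pdf.
    - move=> y _; rewrite -EFinM lee_fin.
      have [ym|my] := lerP `|y| m; last by rewrite fm// !mulr0.
      by rewrite ler_wpM2r ?pdf_ge0//; exact: normal_pdf_shift_le.
  rewrite ge0_integralZl; last 4 first.
  - exact: measurableT.
  - by apply/measurable_EFinP; exact: measurable_pdf.
  - by move=> y _; rewrite lee_fin pdf_ge0.
  - by rewrite lee_fin.
  by rewrite integral_pdf mule1.
apply: (@le_trans _ _ ((g x)^-1 * B ^+ 2)).
  rewrite ler_wpM2l ?invr_ge0 ?normal_pdf_ge0// lerXn2r ?nnegrE//.
  exact: convolution_ge0.
have peak0 := normal_peak_gt0 sigma_neq0.
rewrite centered_normal_pdfE// invfM -expRN /B exprMn -expRM_natl.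
set P := normal_peak sigma; set E1 := expR _; set E2 := expR _.
rewrite [leLHS](_ : _ = P * (E1 * E2)); last by field; rewrite gt_eqF.
rewrite -(mulrA P) ler_pM2l// -!expRD le_eqVlt; apply/orP; left; apply/eqP.
by congr expR; field.
Qed.

(** On [-m, m] the Gaussian is at least its value [c] at the endpoint, so |phi f| is at most B / c
    times |phi| g. *)
Lemma integrable_mul_compact phi m f (B : R) :
  measurable_fun [set: R] phi ->
  (\int[leb]_x (`|phi x| * g x)%:E < +oo)%E ->
  (forall x, m < `|x| -> f x = 0) -> (forall x, f x <= B) ->
  leb.-integrable [set: R] (fun x => (phi x * f x)%:E).
Proof.
move=> mphi phig fm fB; pose c := g m.
have c0 : 0 < c by exact: normal_pdf_gt0.
have mg : measurable_fun [set: R] (fun x => (`|phi x| * g x)%:E).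
  apply/measurable_EFinP; apply: measurable_funM; last exact: measurable_normal_pdf.
  exact: measurableT_comp.
have B0 : 0 <= B by apply: le_trans (fB 0); exact: pdf_ge0.
have ig : leb.-integrable [set: R] (fun x => ((B / c) * (`|phi x| * g x))%:E).
  under eq_fun do rewrite EFinM.
  apply: integrableZl => //; apply/integrableP; split => //.
  under eq_integral do rewrite gee0_abs ?lee_fin ?mulr_ge0 ?normal_pdf_ge0//.
  exact: phig.
apply: le_integrable ig => //.
- by apply/measurable_EFinP; apply: measurable_funM => //; exact: measurable_pdf.
- move=> x _; rewrite lee_fin normrM (ger0_norm (pdf_ge0 f x)).
  have Bg : 0 <= B / c * (`|phi x| * g x).
    by rewrite !mulr_ge0 ?normal_pdf_ge0 ?invr_ge0 ?(ltW c0).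
  rewrite (ger0_norm Bg).
  have [xm|mx] := lerP `|x| m; last first.
    by rewrite fm// mulr0.
  rewrite mulrCA ler_wpM2l//; apply: (le_trans (fB x)).
  rewrite -mulrA ler_peMr// mulrC ler_pdivlMr// mul1r /c !centered_normal_pdfE//.
  rewrite ler_wpM2l ?normal_peak_ge0// ler_expR.
  rewrite ler_wpM2r ?invr_ge0 ?mulr_ge0 ?(ltW sigma_gt0)// lerN2.
  by rewrite -[x ^+ 2]real_normK ?num_real// lerXn2r ?nnegrE// (le_trans _ xm).
Qed.

End compactly_supported_candidates.

(** * Existence of candidates for a non-constant [phi] *)

Section existence_of_candidates.
Context {R : realType} (sigma : R) (sigma_gt0 : 0 < sigma).
Local Notation leb := (@lebesgue_measure R).
Variables (phi : R -> R) (measurable_phi : measurable_fun [set: R] phi).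
Hypothesis phi_g_integrable :
  (\int[leb]_x (`|phi x| * normal_pdf 0 sigma x)%:E < +oo)%E.

Lemma uniform_on_out (A : set R) (m : R) : A `<=` [set` `[- m, m]] ->
  forall x, m < `|x| -> uniform_on_fun A x = 0.
Proof.
move=> Am x mx; rewrite /uniform_on_fun indicE memNset ?mulr0// => /Am/=.
by rewrite in_itv/= -ler_norml leNgt mx.
Qed.

Lemma integrable_uniform_on (A : set R) (m : R) (mA : measurable A)
    (A0 : (0 < leb A)%E) (Aoo : (leb A < +oo)%E) : A `<=` [set` `[- m, m]] ->
  leb.-integrable [set: R] (fun x => (phi x * uniform_on mA A0 Aoo x)%:E).
Proof.
move=> Am; apply: (@integrable_mul_compact _ sigma sigma_gt0 phi m _ (fine (leb A))^-1) => //=.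
  exact: uniform_on_out.
move=> x; rewrite /uniform_on_fun ler_piMr//.
by rewrite invr_ge0 ltW// fine_measure_gt0.
Qed.

Lemma lebesgue_measure_bounded_lty (A : set R) (m : R) : measurable A ->
  A `<=` [set` `[- m, m]] -> (leb A < +oo)%E.
Proof.
move=> mA Am; apply: (@le_lt_trans _ _ (leb [set` `[- m, m]])).
  by apply: le_measure; rewrite ?inE.
by rewrite lebesgue_measure_itv/=; case: ifPn; rewrite ?ltry// -EFinB ltry.
Qed.

(** Turns equality of functionals at uniform densities into equality of integrals over sets, the
    form that [integral_ae_eq] requires. *)
Lemma integral_functional_uniform_on (A : set R) (m : R) (mA : measurable A)
    (A0 : (0 < leb A)%E) (Aoo : (leb A < +oo)%E) : A `<=` [set` `[- m, m]] ->
  (\int[leb]_(x in A) (phi x)%:E =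
   leb A * (functional phi (uniform_on mA A0 Aoo))%:E)%E.
Proof.
move=> Am; have iA := integrable_uniform_on mA A0 Aoo Am.
rewrite /functional /Rintegral fineK; last exact: integrable_fin_num iA.
rewrite -[X in (_ = X * _)%E]fineK ?ge0_fin_numE// -integralZl//.
rewrite [LHS]integral_mkcond; apply: eq_integral => x _.
rewrite epatch_indic -EFinM -EFinM; congr (_%:E).
rewrite /= /uniform_on_fun mulrCA (mulrA (fine _)) divff ?mul1r//.
by rewrite gt_eqF// fine_measure_gt0.
Qed.

Lemma Rintegral_functionalB (f1 f2 : pdf R) :
  leb.-integrable [set: R] (fun x => (phi x * f1 x)%:E) ->
  leb.-integrable [set: R] (fun x => (phi x * f2 x)%:E) ->
  \int[leb]_x (phi x * (f1 x - f2 x)) = functional phi f1 - functional phi f2.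
Proof.
move=> i1 i2; rewrite /functional -RintegralB//.
by apply: eq_Rintegral => x _; rewrite mulrBr.
Qed.

(* If no two uniform densities on bounded sets gave different values to the
   functional, all averages of phi would agree and phi would be constant. *)
Lemma candidates_nonempty :
  ~ (exists c : R, {ae leb, forall x : R, phi x = c}) ->
  exists C_I : R, 0 < C_I /\ candidates sigma phi C_I !=set0.
Proof.
move=> phi_nonconstant; apply: contrapT => noC; apply: phi_nonconstant.
(* Two different averages within [-m, m] would give a candidate pair with [C_I] equal to
   [compact_energy_bound sigma m]. *)
have avg_eq (m : R) (A B : set R) (mA : measurable A) (mB : measurable B) A0 Aoo B0 Boo :
    A `<=` [set` `[- m, m]] -> B `<=` [set` `[- m, m]] ->
    functional phi (@uniform_on _ A mA A0 Aoo) =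
    functional phi (@uniform_on _ B mB B0 Boo).
  move=> Am Bm; apply: contrapT => /eqP neq; apply: noC.
  exists (compact_energy_bound sigma m); split.
    exact: compact_energy_bound_gt0.
  exists (uniform_on mA A0 Aoo), (uniform_on mA A0 Aoo), (uniform_on mB B0 Boo).
  have iA := integrable_uniform_on mA A0 Aoo Am.
  have iB := integrable_uniform_on mB B0 Boo Bm.
  split; last by left.
  split => //.
  - by apply: compact_inverse_weighted_energy => //; exact: uniform_on_out.
  - by apply: compact_inverse_weighted_energy => //; exact: uniform_on_out.
  - by rewrite Rintegral_functionalB// subr_eq0.
(* A fixed reference set, so that the constant [c] does not depend on the interval considered
   later. *)
pose J : set R := [set` `[- 1, 1]].
have mJ : measurable J by exact: measurable_itv.
have J0 : (0 < leb J)%E.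
  rewrite lebesgue_measure_itv/= lte_fin (_ : -1 < 1); last lra.
  by rewrite -EFinB lte_fin; lra.
have Joo : (leb J < +oo)%E by apply: (@lebesgue_measure_bounded_lty J 1).
exists (functional phi (uniform_on mJ J0 Joo)).
set c := functional _ _.
(* Integrability of [phi] is available on bounded intervals, so these are treated one by one and
   combined countably. The radius [n.+1] makes each contain [J]. *)
have ae_n (n : nat) : {ae leb, forall x, [set` `[- n.+1%:R, n.+1%:R]] x -> phi x = c}.
  pose D : set R := [set` `[- n.+1%:R, n.+1%:R]].
  have mD : measurable D by exact: measurable_itv.
  have JD : J `<=` D.
    move=> x; rewrite /J /D /= !in_itv/= => /andP[x1 x2].
    have n1 : 1 <= n.+1%:R :> R by rewrite ler1n.
    apply/andP; split; [apply: le_trans x1; lra|exact: le_trans n1].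
  have DD : D `<=` D by [].
  have D0 : (0 < leb D)%E by apply: (lt_le_trans J0); apply: le_measure; rewrite ?inE.
  have Doo := lebesgue_measure_bounded_lty mD DD.
  have phiD : leb.-integrable D (EFin \o phi).
    have iD := integrable_uniform_on mD D0 Doo DD.
    have iD' : leb.-integrable D (fun x => (fine (leb D))%:E *
        (phi x * uniform_on mD D0 Doo x)%:E)%E.
      apply: (@integrableS _ _ _ leb [set: R] D) => //.
      exact: (integrableZl measurableT (fine (leb D)) iD).
    apply: eq_integrable iD' => //= x xD.
    rewrite -EFinM; congr (_%:E); rewrite /uniform_on_fun indicE xD mulr1.
    by rewrite mulrCA divff ?mulr1// gt_eqF// fine_measure_gt0.
  have phic : (forall E, E `<=` D -> measurable E ->
      \int[leb]_(x in E) (EFin \o phi) x = \int[leb]_(x in E) cst c%:E x)%E.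
    move=> E ED mE; rewrite integral_cst//.
    have Eoo := lebesgue_measure_bounded_lty mE ED.
    (* A null set carries no uniform density; both integrals over it are 0. *)
    have := measure_ge0 leb E; rewrite le_eqVlt => /predU1P[E0|E0].
      rewrite -E0 mule0 null_set_integral//.
      by apply: measurable_funTS; exact/measurable_EFinP.
    rewrite (integral_functional_uniform_on mE E0 Eoo ED) muleC.
    by rewrite (avg_eq _ _ _ mE mJ E0 Eoo J0 Joo ED JD).
  have : ae_eq leb D (EFin \o phi) (cst c%:E) by apply: integral_ae_eq => //.
  by apply: filterS => x /= H Dx; have [] := H Dx.
have := ae_foralln ae_n.
apply: filterS => x Hx; apply: (Hx (Num.truncn `|x|)).
rewrite /= in_itv/= -ler_norml ltW//.
by rewrite truncnS_gt.
Qed.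

End existence_of_candidates.

(** * The minimax lower bound *)

Unset Implicit Arguments.

Theorem corollary4 (R : realType) (sigma : R) (phi : R -> R)
  (mu : nat -> {i01 R})
  (sigma_gt0 : 0 < sigma)
  (mu_gt0 : forall n, 0 < (mu n)%:num)
  (measurable_phi : measurable_fun [set: R] phi)
  (phi_g_integrable :
    (\int[lebesgue_measure]_x (`|phi x| * normal_pdf 0 sigma x)%:E < +oo)%E)
  (phi_nonconstant :
    ~ exists c : R, {ae lebesgue_measure, forall x : R, phi x = c}) :
  (exists C_I : R, 0 < C_I /\ candidates sigma phi C_I !=set0) /\
  (forall C_I : R, 0 < C_I -> candidates sigma phi C_I !=set0 ->
    exists C : R, 0 < C /\
      forall n : nat, (0 < n)%N ->
        ((C * Num.min 1 (n%:R * (mu n)%:num ^+ 2)^-1)%:E <=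
          minimax_risk sigma (mu n) phi n (candidates sigma phi C_I))%E).
Proof.
split; first exact: candidates_nonempty.
move=> C_I C_I0 [_ [f1 [f2 [[E1 E2 i1 i2 + _]]]]].
rewrite Rintegral_functionalB//; set D := functional phi f1 - _ => D0.
have sigma_neq0 : sigma != 0 by rewrite gt_eqF.
have M0 : 0 < 1 + expR (C_I + 2) :> R by rewrite ltr_pwDl// expR_ge0.
(* The 8 is 4, from squaring [e / 2], times 2, since the larger of two risks is at least half their
   sum. The pair is fixed before [n], so the constant is uniform in [n]. *)
exists (D ^+ 2 / (8 * (1 + expR (C_I + 2)))); split.
  by apply: divr_gt0; [rewrite exprn_even_gt0|exact: mulr_gt0].
move=> n n0; set m := (mu n)%:num; set e2 := Num.min 1 _.
have m0 : 0 < m by exact: mu_gt0.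
have nm0 : 0 < n%:R * m ^+ 2 by rewrite mulr_gt0 ?ltr0n// exprn_gt0.
have e2_gt0 : 0 < e2 by rewrite lt_min ltr01 invr_gt0.
(* The largest separation allowed by both e <= 1 and n (m e)^2 <= 1. *)
pose e := Num.sqrt e2.
have e_gt0 : 0 < e by rewrite sqrtr_gt0.
have eE : e ^+ 2 = e2 by rewrite sqr_sqrtr// ltW.
have e_le1 : e <= 1 by rewrite -sqrtr1 ler_wsqrtr// ge_min lexx.
have ne : n%:R * (m * e) ^+ 2 <= 1.
  by rewrite exprMn eE mulrA -ler_pdivlMl// mulr1 ge_min lexx orbT.
have half0 : 0 <= 2^-1 :> R by [].
have half1 : 2^-1 <= 1 :> R by lra.
have te0 : 0 <= (1 - e) / 2 by lra.
have te1 : (1 - e) / 2 <= 1 by lra.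
pose t0 := Itv01 half0 half1; pose te := Itv01 te0 te1.
pose g0 := mixture t0 f1 f2; pose ge := mixture te f1 f2.
(* The functionals of the mixtures differ by [e / 2 * D], nonzero since [e] is positive. *)
have pair : candidate_pair sigma phi C_I g0 ge.
  split.
  - exact: inverse_weighted_energy_mixture.
  - exact: inverse_weighted_energy_mixture.
  - exact: integrable_mixture.
  - exact: integrable_mixture.
  rewrite Rintegral_functionalB ?functional_mixture//=;
    [|exact: integrable_mixture|exact: integrable_mixture].
  rewrite (_ : _ - _ = e / 2 * D); last by rewrite /D; field.
  by rewrite mulf_neq0// gt_eqF// divr_gt0.
have cand0 : candidates sigma phi C_I g0 by exists g0, ge; split => //; left.
have cande : candidates sigma phi C_I ge by exists g0, ge; split => //; right.
apply: le_ereal_inf_tmp => _ [est mest <-]; set S := ereal_sup _.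
have R0S : (risk sigma (mu n) phi est g0 <= S)%E.
  by apply: ereal_sup_ubound; exists g0.
have ReS : (risk sigma (mu n) phi est ge <= S)%E.
  by apply: ereal_sup_ubound; exists ge.
have := @two_point_risk R sigma sigma_neq0 phi f1 f2 C_I E1 E2 i1 i2
  (mu n) t0 te e (mu_gt0 n) (ltW e_gt0) e_le1 erefl erefl n est mest ne (ltW C_I0).
move=> /le_trans/(_ (leeD R0S ReS)).
(* An infinite supremum makes the bound trivial; the value -oo contradicts the finite lower bound on
   the sum of risks. *)
case: S {R0S ReS} => [s| |]; [|by move=> _; rewrite leey|by rewrite addeNy leeNy_eq].
rewrite -EFinD !lee_fin -/D => Ds.
rewrite -eE (_ : _ * _ = (e / 2 * D) ^+ 2 / (1 + expR (C_I + 2)) / 2); last first.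
  by field; rewrite gt_eqF.
by rewrite ler_pdivrMr// mulr_natr mulr2n.
Qed.
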